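(* For every $C_0>0$ there exist $h_0>0$ and $C>0$ such that for all $h\in(0,h_0)$ and every eigenpair $(\lambda,\psi)$ of $\mathfrak{H}_h$ with $\lambda\leq-1+C_0h^{2/3}$, $$\int_{\mathbb{R}^2}|\psi-\Pi_0\psi|^2\,\mathrm{d}x\,\mathrm{d}y\leq Ch^{2/3}\|\psi\|^2,$$ where $\Pi_0\psi(x,y)=\Big(\int_{\mathbb{R}}\psi(x,y')e^{-|y'|}\,\mathrm{d}y'\Big)e^{-|y|}$.
   Context: For $h>0$ let $\mathfrak{Q}_h(\psi)=\int_{\mathbb{R}^2}h^2|\partial_x\psi|^2+|\partial_y\psi|^2\,\mathrm{d}x\,\mathrm{d}y-\int_{\mathbb{R}}|\psi(|s|,s)|^2\,\mathrm{d}s$ on $H^1(\mathbb{R}^2)$ (trace sense) and $\mathfrak{H}_h$ the associated self-adjoint operator on $L^2(\mathbb{R}^2)$. $\|\cdot\|$ is the $L^2(\mathbb{R}^2)$ norm. *)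

(* Defs.v *)
From HB Require Import structures.
From mathcomp Require Import all_boot all_order all_algebra.
From mathcomp Require Import all_classical all_reals all_analysis.
Set Implicit Arguments. Unset Strict Implicit. Unset Printing Implicit Defensive.
Import Order.TTheory GRing.Theory Num.Theory.
Import numFieldNormedType.Exports.
Local Open Scope classical_set_scope.
Local Open Scope ring_scope.

Definition leb2 {R : realType} :=
  ((@lebesgue_measure R) \x (@lebesgue_measure R))%E.

Definition L2_2 {R : realType} (f : R * R -> R) : Prop :=
  measurable_fun (setT : set (measurableTypeR R * measurableTypeR R)) f /\
  (\int[leb2]_z ((f z) ^+ 2)%:E < +oo)%E.

Definition L2_1 {R : realType} (f : R -> R) : Prop :=
  measurable_fun (setT : set (measurableTypeR R)) f /\
  (\int[@lebesgue_measure R]_s ((f s) ^+ 2)%:E < +oo)%E.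

Definition dX {R : realType} (phi : R * R -> R) (z : R * R) : R :=
  derive1 (fun t => phi (t, z.2)) z.1.
Definition dY {R : realType} (phi : R * R -> R) (z : R * R) : R :=
  derive1 (fun t => phi (z.1, t)) z.2.

Definition C1c {R : realType} (phi : R * R -> R) : Prop :=
  (exists M : R, forall z : R * R, M < `|z.1| \/ M < `|z.2| -> phi z = 0) /\
  (forall z : R * R, derivable (fun t => phi (t, z.2)) z.1 1 /\
                     derivable (fun t => phi (z.1, t)) z.2 1) /\
  continuous phi /\ continuous (dX phi) /\ continuous (dY phi).

Definition H1 {R : realType} (psi gx gy : R * R -> R) : Prop :=
  L2_2 psi /\ L2_2 gx /\ L2_2 gy /\
  forall phi, C1c phi ->
    (\int[leb2]_z (psi z * dX phi z)%:E = - \int[leb2]_z (gx z * phi z)%:E)%E /\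
    (\int[leb2]_z (psi z * dY phi z)%:E = - \int[leb2]_z (gy z * phi z)%:E)%E.

Definition trace_on_curve {R : realType} (psi gx gy : R * R -> R) (tau : R -> R)
  : Prop :=
  L2_1 tau /\
  exists phi : nat -> R * R -> R, (forall n, C1c (phi n)) /\
    ((fun n => \int[leb2]_z ((phi n z - psi z) ^+ 2)%:E
             + \int[leb2]_z ((dX (phi n) z - gx z) ^+ 2)%:E
             + \int[leb2]_z ((dY (phi n) z - gy z) ^+ 2)%:E)%E
       @ \oo --> 0%E) /\
    ((fun n => \int[@lebesgue_measure R]_s ((phi n (`|s|, s) - tau s) ^+ 2)%:E)%E
       @ \oo --> 0%E).

Definition H1tr {R : realType} (psi gx gy : R * R -> R) (tau : R -> R) : Prop :=
  H1 psi gx gy /\ trace_on_curve psi gx gy tau.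

Definition ip2 {R : realType} (u v : R * R -> R) : R :=
  Rintegral leb2 setT (fun z => u z * v z).

Definition Qform {R : realType} (h : R) (ux uy vx vy : R * R -> R)
  (tu tv : R -> R) : R :=
  h ^+ 2 * ip2 ux vx + ip2 uy vy
  - Rintegral (@lebesgue_measure R) setT (fun s => tu s * tv s).

(* (lam, psi) is an eigenpair of the self-adjoint operator H_h associated with
   Q_h (Kato's representation theorem): psi is in the form domain H^1, nonzero,
   and Q_h(psi, phi) = lam <psi, phi> for all phi in H^1.  Complex psi is
   represented as psi = u + i w with u, w real; since Q_h has real
   coefficients and lam is real, the complex identity for all complex phi is
   literally the conjunction of the two real identities below. *)
Definition eigenpair {R : realType} (h lam : R) (u w : R * R -> R) : Prop :=
  exists (ux uy wx wy : R * R -> R) (tu tw : R -> R),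
    H1tr u ux uy tu /\ H1tr w wx wy tw /\
    (0 < \int[leb2]_z ((u z) ^+ 2 + (w z) ^+ 2)%:E)%E /\
    forall (v vx vy : R * R -> R) (tv : R -> R), H1tr v vx vy tv ->
      Qform h ux uy vx vy tu tv = lam * ip2 u v /\
      Qform h wx wy vx vy tw tv = lam * ip2 w v.

Definition Pi0 {R : realType} (psi : R * R -> R) (z : R * R) : R :=
  Rintegral (@lebesgue_measure R) setT (fun y' => psi (z.1, y') * expR (- `|y'|))
  * expR (- `|z.2|).

(* Main.v *)
Require Import Defs.
From mathcomp Require Import all_boot all_order all_algebra.
From mathcomp Require Import all_classical all_reals all_analysis.
From mathcomp Require Import measurable_realfun ring lra.
Import Order.TTheory GRing.Theory Num.Theory.
Import numFieldNormedType.Exports.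
Local Open Scope classical_set_scope.
Local Open Scope ring_scope.
Set Implicit Arguments. Unset Strict Implicit. Unset Printing Implicit Defensive.

(** Discard the nonnegative term h^2 |d_x psi|^2: everything is one-dimensional
    in y. On the slice x >= 0, put E(y) = e^{-|y|} and u = g - g(0) E. Completing
    squares on |y| <= x and on |y| >= x separately gives
      2 g(x)^2 + 2 g(-x)^2 + ||u||^2 <= 2 (||g'||^2 + ||g||^2),
    a spectral gap above -1 that is uniform in x. Integrated over x it reads
    2 ||trace||^2 + ||phi - phi(., 0) E||^2 <= 2 (||d_y phi||^2 + ||phi||^2), and
    since Pi_0 psi is the best approximation of psi by functions b(x) E(y), it
    yields, after passing to the limit along smooth approximants phi of psi,
      ||psi - Pi_0 psi||^2 + 4 ||trace||^2 <= 4 (||d_y psi||^2 + ||psi||^2).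
    For an eigenpair the right-hand side minus the trace term is at most
    4 (lam + 1) ||psi||^2. Hence h0 = 1 and C = 4 C0 work. *)

(** * One-dimensional trace inequality on a slice *)

(** [H] is meant to carry the cross terms left over when squares are completed; its derivative is
    integrated by the fundamental theorem of calculus. The boundary values are kept as added terms,
    so that bounds on adjacent intervals can be summed. *)
Lemma integral_le_derive (R : realType) (p q H : R -> R) (a b : R) : a <= b ->
  continuous p -> continuous q ->
  (forall y, derivable H y 1) -> continuous (derive1 H) ->
  (forall y, a <= y <= b -> q y + derive1 H y <= p y) ->
  (\int[@lebesgue_measure R]_(y in `[a, b]) (q y)%:E + (H b)%:E <=
   \int[@lebesgue_measure R]_(y in `[a, b]) (p y)%:E + (H a)%:E)%E.
Proof.
move=> ab cp cq dH cH le_pq.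
(* The degenerate interval does occur, for a trace point at the origin, while the fundamental
   theorem of calculus asks for [a < b]. *)
have [<-|nab] := eqVneq a b.
  by rewrite set_itv1 !integral_set1.
have {}ab : a < b by rewrite lt_neqAle nab ab.
have int (f : R -> R) : continuous f ->
    (@lebesgue_measure R).-integrable `[a, b] (EFin \o f).
  move=> cf; apply: continuous_compact_integrable; first exact: segment_compact.
  exact: continuous_subspaceT.
have cHH : continuous H.
  by move=> y; apply/differentiable_continuous/derivable1_diffP.
have FTC : (\int[@lebesgue_measure R]_(y in `[a, b]) (derive1 H y)%:E =
    (H b)%:E - (H a)%:E)%E.
  apply: continuous_FTC2 => //; first exact: continuous_subspaceT.
  split => //.
  - by apply: cvg_at_right_filter; exact: cHH.
  - by apply: cvg_at_left_filter; exact: cHH.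
have : (\int[@lebesgue_measure R]_(y in `[a, b]) ((q y)%:E + (derive1 H y)%:E) <=
        \int[@lebesgue_measure R]_(y in `[a, b]) (p y)%:E)%E.
  apply: le_integral => //.
  - exact: (integrableD _ (int _ cq) (int _ cH)).
  - exact: int.
  - move=> y; rewrite inE/= in_itv/= => yab.
    by rewrite -EFinD lee_fin; exact: le_pq.
rewrite (integralD_EFin _ (int _ cq) (int _ cH))//= FTC.
have := integrable_fin_num _ (int _ cq); have := integrable_fin_num _ (int _ cp).
move=> /(_ _)/fineK <-// /(_ _)/fineK <-//.
by rewrite -!EFinD !lee_fin; lra.
Qed.

Lemma lee_shift (R : realDomainType) (X Y : \bar R) (a b : R) :
  (X + a%:E <= Y + b%:E -> X + (a - b)%:E <= Y)%E.
Proof.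
case: X Y => [x| |] [y| |] //=; first by rewrite -!EFinD !lee_fin; lra.
by move=> _; rewrite leey.
by move=> _; rewrite leNye.
Qed.

(** With [u = g - g(0) e^{-y}] one has [u + u' = g + g'], hence [u^2 + (u^2)' = (g + g')^2 - u'^2],
    and [2 (g'^2 + g^2)] exceeds this by [(g' - g)^2 + u'^2]. The trace term comes from using
    different primitives on the two sides of [x]. *)
Lemma half_line_trace (R : realType) (g : R -> R) (x M : R) : 0 <= x ->
  (forall y, derivable g y 1) -> continuous (derive1 g) ->
  (forall y, M < y -> g y = 0) ->
  (\int[@lebesgue_measure R]_(y in `[0%R, +oo[)
       ((g y - g 0 * expR (- y)) ^+ 2)%:E + (2 * g x ^+ 2)%:E <=
   \int[@lebesgue_measure R]_(y in `[0%R, +oo[)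
       (2 * (derive1 g y ^+ 2 + g y ^+ 2))%:E)%E.
Proof.
move=> x0 dg cdg gM.
pose g' : R -> R := derive1 g; pose u (y : R) : R := g y - g 0 * expR (- y).
pose u' (y : R) : R := g' y + g 0 * expR (- y).
pose q (y : R) : R := u y ^+ 2; pose p (y : R) : R := 2 * (g' y ^+ 2 + g y ^+ 2).
have idg (y : R) : is_derive y 1 g (g' y).
  by rewrite /g' derive1E; apply: derivableP.
have idu (y : R) : is_derive y 1 u (u' y).
  rewrite /u; apply: is_derive_eq.
  by rewrite /u' /GRing.scale/=; ring.
have cg : continuous g.
  by move=> y; apply/differentiable_continuous/derivable1_diffP.
have cE : continuous (fun y : R => g 0 * expR (- y)).
  move=> y; apply: cvgM; first exact: cvg_cst.
  by apply: continuous_comp; [exact: continuousN|exact: continuous_expR].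
have cu : continuous u by move=> y; apply: cvgB; [exact: cg|exact: cE].
have cu' : continuous u' by move=> y; apply: cvgD; [exact: cdg|exact: cE].
have csqr (f : R -> R) : continuous f -> continuous (fun y => f y ^+ 2).
  move=> cf y; apply: (@continuous_comp _ _ _ f (fun z : R => z ^+ 2)).
    exact: cf.
  exact: exprn_continuous.
have cp : continuous p.
  move=> y; apply: cvgM; first exact: cvg_cst.
  by apply: cvgD; [exact: (csqr _ cdg)|exact: (csqr _ cg)].
have cq : continuous q by exact: (csqr _ cu).
(* [H1] serves on [[0, x]] and [H2] on [[x, +oo[]; their jump [H1 x - H2 x = 2 g(x)^2] is the trace
   term. Subtracting [2 g^2] only turns the square [(g' - g)^2] into [(g' + g)^2]. *)
pose H1 (y : R) : R := u y ^+ 2; pose H2 (y : R) : R := u y ^+ 2 - 2 * g y ^+ 2.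
have idH1 (y : R) : is_derive y 1 H1 (2 * u y * u' y).
  by rewrite /H1; apply: is_derive_eq; rewrite /GRing.scale/=; ring.
have idH2 (y : R) : is_derive y 1 H2 (2 * u y * u' y - 4 * g y * g' y).
  by rewrite /H2; apply: is_derive_eq; rewrite /GRing.scale/=; ring.
have dH1 : derive1 H1 = fun y => 2 * u y * u' y.
  by apply/funext => y; rewrite derive1E; apply: derive_val.
have dH2 : derive1 H2 = fun y => 2 * u y * u' y - 4 * g y * g' y.
  by apply/funext => y; rewrite derive1E; apply: derive_val.
have cdH1 : continuous (derive1 H1).
  rewrite dH1 => y; apply: cvgM; last exact: cu'.
  by apply: cvgM; [exact: cvg_cst|exact: cu].
have cdH2 : continuous (derive1 H2).
  have cuu' : continuous (fun y => 2 * u y * u' y) by rewrite -dH1.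
  rewrite dH2 => y; apply: cvgB; first exact: cuu'.
  apply: cvgM; last exact: cdg.
  by apply: cvgM; [exact: cvg_cst|exact: cg].
have u0 : u 0 = 0 by rewrite /u oppr0 expR0; ring.
(* [p - q - H1' = (g' - g)^2 + u'^2] *)
have le1 : (\int[@lebesgue_measure R]_(y in `[0%R, x]) (q y)%:E + (H1 x)%:E <=
   \int[@lebesgue_measure R]_(y in `[0%R, x]) (p y)%:E + (H1 0)%:E)%E.
  apply: (integral_le_derive _ cp cq _ cdH1) => [//|y|y _].
    exact: (ex_derive (is_derive := idH1 y)).
  rewrite dH1 /q /p.
  rewrite -subr_ge0 (_ : _ - _ = (g' y - g y) ^+ 2 + u' y ^+ 2).
    by rewrite addr_ge0// sqr_ge0.
  by rewrite /u /u'; ring.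
(* [p - q - H2' = (g + g')^2 + u'^2] *)
have le2 N : x <= N ->
  (\int[@lebesgue_measure R]_(y in `[x, N]) (q y)%:E + (H2 N)%:E <=
   \int[@lebesgue_measure R]_(y in `[x, N]) (p y)%:E + (H2 x)%:E)%E.
  move=> xN; apply: (integral_le_derive _ cp cq _ cdH2) => [//|y|y _].
    exact: (ex_derive (is_derive := idH2 y)).
  rewrite dH2 /q /p.
  rewrite -subr_ge0 (_ : _ - _ = (g' y + g y) ^+ 2 + u' y ^+ 2).
    by rewrite addr_ge0// sqr_ge0.
  by rewrite /u /u'; ring.
have q0 y : 0 <= q y by exact: sqr_ge0.
have p0 y : 0 <= p y by rewrite mulr_ge0// addr_ge0// sqr_ge0.
have mf (f : R -> R) (A : set (measurableTypeR R)) : continuous f ->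
    measurable_fun A f.
  by move=> cf; apply: measurable_funTS; exact: continuous_measurable_fun.
have split (f : R -> R) : continuous f -> (forall y, 0 <= f y) ->
    (\int[@lebesgue_measure R]_(y in `[0%R, +oo[) (f y)%:E =
     \int[@lebesgue_measure R]_(y in `[0%R, x]) (f y)%:E +
     \int[@lebesgue_measure R]_(y in `[x, +oo[) (f y)%:E)%E.
  move=> cf f0; rewrite (@itv_bndbnd_setU _ _ _ (BLeft x))// ?bnd_simp//.
  rewrite ge0_integral_setU//=; last 3 first.
  - by apply/measurable_EFinP; exact: mf.
  - by move=> y _; rewrite lee_fin.
  - rewrite disj_set2E; apply/eqP; rewrite -subset0 => y/=.
    by rewrite !in_itv/= andbT => -[/andP[_]]; rewrite ltNge => /negP.
  by rewrite integral_itv_bndo_bndc//; apply/measurable_EFinP; exact: mf.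
have le3 : (\int[@lebesgue_measure R]_(y in `[x, +oo[) (q y)%:E <=
   \int[@lebesgue_measure R]_(y in `[x, +oo[) (p y)%:E + (H2 x)%:E)%E.
  have cvgq : (\int[@lebesgue_measure R]_(y in `[x, (x + n%:R)%R]) (q y)%:E)%E
      @[n --> \oo] --> (\int[@lebesgue_measure R]_(y in `[x, +oo[) (q y)%:E)%E.
    rewrite itv_bndy_bigcup_BRight; apply: ge0_nondecreasing_set_cvg_integral.
    - move=> m n mn; rewrite subsetEset => y/=; rewrite !in_itv/=.
      move=> /andP[-> /le_trans]; apply; rewrite lerD2l ler_nat//.
    - by [].
    - by move=> n; apply/measurable_EFinP; exact: mf.
    - by move=> n y _; rewrite lee_fin.
  apply: (cvge_to_le cvgq); near=> n.
  have Mn : M < x + n%:R.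
    by rewrite -ltrBlDl; near: n; exact: nbhs_infty_gtr.
  have xn : x <= x + n%:R by rewrite lerDl.
  apply: (@le_trans _ _ (\int[@lebesgue_measure R]_(y in `[x, (x + n%:R)%R]) (p y)%:E + (H2 x)%:E)%E).
    apply: le_trans (le2 _ xn); rewrite leeDl// lee_fin /H2 (gM _ Mn).
    by have := sqr_ge0 (u (x + n%:R)); lra.
  rewrite leeD2r//; apply: ge0_subset_integral => //.
  - by apply/measurable_EFinP; exact: mf.
  - by move=> y _; rewrite lee_fin.
  - exact: subset_itvl.
rewrite (split q)// (split p)//.
(* The boundary term at the origin vanishes because [u 0 = 0], which leaves the jump [H1 x - H2 x].
   The integrals may be infinite, so only the real constants are moved across. *)
have := leeD le1 le3; rewrite [X in (X <= _)%E -> _]addeAC [X in (_ <= X)%E -> _]addeACA -EFinD.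
move=> /lee_shift; congr (_ + _ <= _)%E; congr EFin.
by rewrite /H1 /H2 u0; ring.
Unshelve. all: by end_near. Qed.

Lemma measurable_expRNnorm (R : realType) :
  measurable_fun (setT : set (measurableTypeR R)) (fun y : R => expR (- `|y|)).
Proof.
apply: measurableT_comp; first exact: measurable_expR.
by apply: measurableT_comp; [exact: oppr_measurable|exact: normr_measurable].
Qed.

(** Reflection of the negative half-line; the origin is counted in both integrals, harmlessly, since
    a point is null. *)
Lemma integral_fold (R : realType) (F : R -> \bar R) :
  measurable_fun (setT : set (measurableTypeR R)) F -> (forall y, 0 <= F y)%E ->
  (\int[@lebesgue_measure R]_y F y =
   \int[@lebesgue_measure R]_(y in `[0%R, +oo[) F y +
   \int[@lebesgue_measure R]_(y in `[0%R, +oo[) F (- y)%R)%E.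
Proof.
move=> mF F0.
have mFN : measurable_fun (setT : set (measurableTypeR R)) (fun y => F (- y)).
  by apply: (measurableT_comp mF); exact: oppr_measurable.
rewrite -(itv_setU_setT true 0%R) ge0_integral_setU//=; last 2 first.
- exact: measurable_funS mF.
- rewrite disj_set2E; apply/eqP; rewrite -subset0 => y/=.
  by rewrite !in_itv/= andbT => -[]; rewrite ltNge => /negP.
rewrite addeC; congr (_ + _)%E.
rewrite ge0_integration_by_substitution0//.
under [RHS]eq_integral do rewrite opprK.
by rewrite integral_itv_bndo_bndc//; exact: measurable_funS mF.
Qed.

(** The half-line bound is applied to [g] and to its reflection. Both take the value [g 0] at the
    origin, so the same multiple of [e^{-|y|}] is subtracted on the two sides. *)
Lemma line_trace (R : realType) (g : R -> R) (x M : R) : 0 <= x ->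
  (forall y, derivable g y 1) -> continuous (derive1 g) ->
  (forall y, M < `|y| -> g y = 0) ->
  (\int[@lebesgue_measure R]_y ((g y - g 0 * expR (- `|y|)) ^+ 2)%:E +
     (2 * (g x ^+ 2 + g (- x) ^+ 2))%:E <=
   \int[@lebesgue_measure R]_y (2 * (derive1 g y ^+ 2 + g y ^+ 2))%:E)%E.
Proof.
move=> x0 dg cdg gM.
have cg : continuous g.
  by move=> y; apply/differentiable_continuous/derivable1_diffP.
have idg (y : R) : is_derive y 1 g (derive1 g y).
  by rewrite derive1E; apply: derivableP.
pose gN y := g (- y).
have idgN (y : R) : is_derive y 1 gN (- derive1 g (- y)).
  have iN : is_derive y 1 (-%R : R -> R) (- 1) by exact: is_deriveN.
  have := is_derive1_comp (idg (- y)) iN.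
  by rewrite /GRing.scale/= mulrN1.
have dgN : derive1 gN = fun y => - derive1 g (- y).
  by apply/funext => y; rewrite derive1E; apply: derive_val.
have mg : measurable_fun (setT : set (measurableTypeR R)) g.
  exact: continuous_measurable_fun.
have mdg : measurable_fun (setT : set (measurableTypeR R)) (derive1 g).
  exact: continuous_measurable_fun.
have mE := @measurable_expRNnorm R.
rewrite [X in (X + _ <= _)%E]integral_fold; last 2 first.
- apply/measurable_EFinP; apply: measurable_funX; apply: measurable_funB => //.
  exact: measurable_funM.
- by move=> y; rewrite lee_fin sqr_ge0.
rewrite [X in (_ <= X)%E]integral_fold; last 2 first.
- apply/measurable_EFinP; apply: measurable_funM => //.
  by apply: measurable_funD => //; exact: measurable_funX.
- by move=> y; rewrite lee_fin mulr_ge0// addr_ge0// sqr_ge0.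
have -> : (2 * (g x ^+ 2 + g (- x) ^+ 2))%:E =
    ((2 * g x ^+ 2)%:E + (2 * g (- x) ^+ 2)%:E)%E by rewrite -EFinD; congr EFin; ring.
rewrite addeACA; apply: leeD.
  apply: le_trans (half_line_trace (M := M) x0 dg cdg _); last first.
    by move=> y My; apply: gM; rewrite (lt_le_trans My)// ler_norm.
  apply: leeD; last exact: lexx.
  rewrite le_eqVlt; apply/orP; left; apply/eqP.
  by apply: eq_integral => y; rewrite inE/= in_itv/= andbT => y0; rewrite ger0_norm.
have foldN : (\int[@lebesgue_measure R]_(y in `[0%R, +oo[)
      (2 * (derive1 gN y ^+ 2 + gN y ^+ 2))%:E =
    \int[@lebesgue_measure R]_(y in `[0%R, +oo[)
      (2 * (derive1 g (- y) ^+ 2 + g (- y) ^+ 2))%:E)%E.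
  by apply: eq_integral => y _; rewrite dgN sqrrN.
rewrite -foldN; apply: le_trans (half_line_trace (M := M) x0 _ _ _).
- apply: leeD; last exact: lexx.
  rewrite le_eqVlt; apply/orP; left; apply/eqP.
  apply: eq_integral => y; rewrite inE/= in_itv/= andbT => y0.
  by rewrite /gN oppr0 normrN ger0_norm.
- by move=> y; apply: (ex_derive (is_derive := idgN y)).
- by rewrite dgN => y; apply: cvgN; apply: continuous_comp; [exact: continuousN|exact: cdg].
- move=> y My; apply: (gM (- y)); rewrite normrN.
  exact: lt_le_trans My (ler_norm _).
Qed.

(** * The normalised profile and L^2 inequalities *)

(** Folding gives [2 e^{-2y}] on the half-line, the exponential density of rate 2, whose total mass
    is 1. Thus [e^{-|y|}] is a unit vector, as an orthogonal projection requires. *)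
Lemma integral_expRNnorm_sqr (R : realType) :
  (\int[@lebesgue_measure R]_y (expR (- `|y|) ^+ 2)%:E = 1)%E.
Proof.
rewrite integral_fold; last 2 first.
- by apply/measurable_EFinP/measurable_funX; exact: measurable_expRNnorm.
- by move=> y; rewrite lee_fin sqr_ge0.
under [X in (_ + X)%E]eq_integral do rewrite normrN.
rewrite -(@integral_exponential_pdf R 2)// [RHS]integral_fold; last 2 first.
- by apply/measurable_EFinP; exact: measurable_exponential_pdf.
- by move=> y; rewrite lee_fin exponential_pdf_ge0.
(* The density vanishes on strictly negative arguments but not at 0, so the endpoint is removed
   before the integrand is identified with 0. *)
rewrite [X in _ = (_ + X)%E](_ : _ = 0%E); last first.
  rewrite -integral_itv_obnd_cbnd; last first.
    apply/measurable_EFinP/measurable_funTS; apply: measurableT_comp; last exact: oppr_measurable.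
    exact: measurable_exponential_pdf.
  apply: integral0_eq => y/=; rewrite in_itv/= andbT => y0.
  by rewrite lt0_exponential_pdf// oppr_lt0.
rewrite adde0 -ge0_integralD//=.
- apply: eq_integral => y; rewrite inE/= in_itv/= andbT => y0.
  rewrite exponential_pdfE// -EFinD ger0_norm//; congr EFin.
  by rewrite mulNr -mulrN expRM_natl; ring.
- apply/measurable_EFinP/measurable_funTS/measurable_funX.
  exact: measurable_expRNnorm.
- apply/measurable_EFinP/measurable_funTS/measurable_funX.
  exact: measurable_expRNnorm.
Qed.

Lemma sqr_integrable d (T : measurableType d) (R : realType)
    (mu : {measure set T -> \bar R}) (f : T -> R) :
  measurable_fun setT f -> (\int[mu]_t (f t ^+ 2)%:E < +oo)%E ->
  mu.-integrable setT (EFin \o (fun t => f t ^+ 2)).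
Proof.
move=> mf foo; apply/integrableP; split.
  by apply/measurable_EFinP; exact: measurable_funX.
by under eq_integral do rewrite /= ger0_norm ?sqr_ge0//.
Qed.

Lemma mul_integrable d (T : measurableType d) (R : realType)
    (mu : {measure set T -> \bar R}) (f g : T -> R) :
  measurable_fun setT f -> (\int[mu]_t (f t ^+ 2)%:E < +oo)%E ->
  measurable_fun setT g -> (\int[mu]_t (g t ^+ 2)%:E < +oo)%E ->
  mu.-integrable setT (EFin \o (fun t => f t * g t)).
Proof.
move=> mf foo mg goo.
have ifg : mu.-integrable setT (EFin \o (fun t => f t ^+ 2 + g t ^+ 2)).
  by apply: (integrableD measurableT (sqr_integrable mf foo) (sqr_integrable mg goo)).
apply: (le_integrable measurableT _ _ ifg).
- by apply/measurable_EFinP; exact: measurable_funM.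
- move=> t _ /=; rewrite lee_fin [leRHS]ger0_norm ?addr_ge0 ?sqr_ge0// ler_norml.
  have := sqr_ge0 (f t - g t); have := sqr_ge0 (f t + g t).
  have := sqr_ge0 (f t); have := sqr_ge0 (g t).
  rewrite sqrrD sqrrB; lra.
Qed.

(** Put [V = f - b e] and [dd = <V, e>]. Since [e] is a unit vector, the coefficient [<f, e>] equals
    [dd + b], and the squared distance on the left is [||V||^2 - dd^2]. *)
Lemma best_approximation d (T : measurableType d) (R : realType)
    (mu : {measure set T -> \bar R}) (e f : T -> R) (b : R) :
  measurable_fun setT e -> (\int[mu]_t (e t ^+ 2)%:E = 1)%E ->
  measurable_fun setT f ->
  (\int[mu]_t ((f t - Rintegral mu setT (fun s => f s * e s) * e t) ^+ 2)%:E <=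
   \int[mu]_t ((f t - b * e t) ^+ 2)%:E)%E.
Proof.
move=> me e1 mf; pose V t := f t - b * e t.
have mV : measurable_fun setT V.
  by apply: measurable_funB => //; exact: measurable_funM.
(* An infinite right-hand side makes the bound trivial; this lets the lemma be applied on every
   slice, including exceptional slices that are not square integrable. *)
have [Voo|] := ltP (\int[mu]_t (V t ^+ 2)%:E)%E +oo%E; last exact: le_trans (leey _).
have eoo : (\int[mu]_t (e t ^+ 2)%:E < +oo)%E by rewrite e1 ltry.
have iV := sqr_integrable mV Voo; have ie := sqr_integrable me eoo.
have iVe := mul_integrable mV Voo me eoo.
have Re1 : Rintegral mu setT (fun t => e t ^+ 2) = 1 by rewrite /Rintegral e1.
have iZ (k : R) (F : T -> R) : mu.-integrable setT (EFin \o F) ->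
    mu.-integrable setT (EFin \o (fun t => k * F t)).
  by move=> iF; have := integrableZl measurableT k iF.
pose dd := Rintegral mu setT (fun t => V t * e t).
have -> : Rintegral mu setT (fun s => f s * e s) = dd + b.
  rewrite -[in RHS](mulr1 b) -Re1 -RintegralZl// /dd -RintegralD//; last exact: iZ.
  by apply: eq_Rintegral => t _; rewrite /V; ring.
have -> : (\int[mu]_t ((f t - (dd + b) * e t) ^+ 2)%:E =
   \int[mu]_t ((V t ^+ 2)%:E + (dd ^+ 2 * e t ^+ 2 - (2 * dd) * (V t * e t))%:E))%E.
  by apply: eq_integral => t _; rewrite -EFinD; congr EFin; rewrite /V; ring.
have iB : mu.-integrable setT
    (EFin \o (fun t => dd ^+ 2 * e t ^+ 2 - (2 * dd) * (V t * e t))).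
  by apply: (integrableB measurableT (iZ (dd ^+ 2) _ ie) (iZ (2 * dd) _ iVe)).
rewrite (integralD_EFin measurableT iV iB) -[leRHS]adde0 leeD2l//.
rewrite -(fineK (integrable_fin_num measurableT iB)) lee_fin.
rewrite (_ : fine _ = dd ^+ 2 * Rintegral mu setT (fun t => e t ^+ 2) -
    (2 * dd) * Rintegral mu setT (fun t => V t * e t)); last first.
  rewrite -!RintegralZl// -RintegralB//; [exact: iZ|exact: iZ].
by rewrite Re1 -/dd; have := sqr_ge0 dd; lra.
Qed.

(** Pointwise, right side minus left side is the weighted square [e^{-1} (e g - (f - g))^2]. *)
Lemma sqr_integral_young d (T : measurableType d) (R : realType)
    (mu : {measure set T -> \bar R}) (f g : T -> R) (e : R) : 0 < e ->
  measurable_fun setT f -> measurable_fun setT g ->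
  (\int[mu]_t (f t ^+ 2)%:E <= (1 + e)%:E * \int[mu]_t (g t ^+ 2)%:E +
     (1 + e^-1)%:E * \int[mu]_t ((f t - g t) ^+ 2)%:E)%E.
Proof.
move=> e0 mf mg.
have mfg : measurable_fun setT (fun t => f t - g t) by exact: measurable_funB.
have ei0 : 0 < e^-1 by rewrite invr_gt0.
have m2 (h : T -> R) : measurable_fun setT h ->
    measurable_fun setT (fun t => (h t ^+ 2)%:E).
  by move=> mh; apply/measurable_EFinP; exact: measurable_funX.
have mZ (k : R) (h : T -> R) : measurable_fun setT h ->
    measurable_fun setT (fun t => k%:E * (h t ^+ 2)%:E)%E.
  by move=> mh; apply: measurable_funeM; exact: m2.
rewrite -!ge0_integralZl_EFin//; [|by move=> *; rewrite lee_fin sqr_ge0|exact: m2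
  |lra|by move=> *; rewrite lee_fin sqr_ge0|exact: m2|lra].
rewrite -ge0_integralD//; last 4 first.
- by move=> t _; rewrite -EFinM lee_fin mulr_ge0 ?sqr_ge0//; lra.
- exact: mZ.
- by move=> t _; rewrite -EFinM lee_fin mulr_ge0 ?sqr_ge0//; lra.
- exact: mZ.
apply: ge0_le_integral => //.
- by move=> t _; rewrite lee_fin sqr_ge0.
- exact: m2.
- by apply: emeasurable_funD; exact: mZ.
move=> t _; rewrite -!EFinM -EFinD lee_fin -subr_ge0.
rewrite (_ : _ - _ = e^-1 * (e * g t - (f t - g t)) ^+ 2).
  by rewrite mulr_ge0 ?sqr_ge0// ltW.
by field; rewrite gt_eqF.
Qed.

(** * Measurability in the plane *)

(** The sigma-algebra here is the product one, generated by rectangles. An open set is the countable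
    union of the rational rectangles that it contains; the other rational rectangles are replaced by
    [set0]. *)
Lemma open_prod_measurable (R : realType) (U : set (R * R)) : open U ->
  measurable (U : set (measurableTypeR R * measurableTypeR R)).
Proof.
move=> oU.
pose rect (q : (rat * rat) * (rat * rat)) : set (R * R) :=
  `]ratr q.1.1, ratr q.1.2[ `*` `]ratr q.2.1, ratr q.2.2[.
rewrite (_ : U = \bigcup_q (if `[< rect q `<=` U >] then rect q else set0)).
  apply: countable_bigcupT_measurable; first exact: countableP.
  move=> q; case: ifPn => _; last exact: measurable0.
  by apply: measurableX; exact: measurable_itv.
apply/seteqP; split=> [[x y] Uxy|z [q _]]; last first.
  by case: ifPn => // /asboolP; apply.
have /nbhs_ballP[r /= r0 rU] : nbhs (x, y) U by exact: open_nbhs_nbhs.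
have rx : x - r < x /\ x < x + r by split; lra.
have ry : y - r < y /\ y < y + r by split; lra.
have [a] := rat_in_itvoo rx.1; rewrite in_itv/= => /andP[a1 a2].
have [b] := rat_in_itvoo rx.2; rewrite in_itv/= => /andP[b1 b2].
have [c] := rat_in_itvoo ry.1; rewrite in_itv/= => /andP[c1 c2].
have [d] := rat_in_itvoo ry.2; rewrite in_itv/= => /andP[d1 d2].
exists ((a, b), (c, d)) => //; rewrite ifT.
  by rewrite /rect; split; rewrite /= in_itv/= ?a2 ?b1 ?c2 ?d1.
apply/asboolP => -[s t] []; rewrite /= !in_itv/= => /andP[s1 s2] /andP[t1 t2].
by apply: rU; split; rewrite /ball/= ltr_distlC; apply/andP; split; lra.
Qed.

Lemma continuous_prod_measurable (R : realType) (f : R * R -> R) : continuous f ->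
  measurable_fun (setT : set (measurableTypeR R * measurableTypeR R)) f.
Proof.
move=> /continuousP cf; apply: (measurability _ (RGenOpens.measurableE R)).
move=> _ [_ [a [b ->] <-]]; rewrite setTI; apply: open_prod_measurable.
by apply: cf; exact: interval_open.
Qed.

Lemma measurable_slice (R : realType) (f : R * R -> R) (x : R) :
  measurable_fun (setT : set (measurableTypeR R * measurableTypeR R)) f ->
  measurable_fun (setT : set (measurableTypeR R)) (fun y => f (x, y)).
Proof. by move=> mf; apply: (measurableT_comp mf); exact: measurable_pair1. Qed.

Lemma measurable_snd_expRNnorm (R : realType) (b : R -> R) :
  measurable_fun (setT : set (measurableTypeR R)) b ->
  measurable_fun (setT : set (measurableTypeR R * measurableTypeR R))
    (fun z : R * R => b z.1 * expR (- `|z.2|)).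
Proof.
move=> mb; apply: measurable_funM.
  by apply: (measurableT_comp mb); exact: measurable_fst.
by apply: (measurableT_comp (@measurable_expRNnorm R)); exact: measurable_snd.
Qed.

(** * Smooth functions: integration over the slices *)

(** Tonelli reduces both plane integrals to slices of fixed [x], where [line_trace] applies with the
    profile coefficient [phi (x, 0)]. *)
Lemma C1c_trace_ineq (R : realType) (phi : R * R -> R) : C1c phi ->
  (\int[leb2]_z ((phi z - phi (z.1, 0) * expR (- `|z.2|)) ^+ 2)%:E +
     2%:E * \int[@lebesgue_measure R]_s (phi (`|s|, s) ^+ 2)%:E <=
   2%:E * (\int[leb2]_z (dY phi z ^+ 2)%:E + \int[leb2]_z (phi z ^+ 2)%:E))%E.
Proof.
move=> [[M phiM] [dphi [cphi [_ cdY]]]].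
have mphi := continuous_prod_measurable cphi.
have mdY := continuous_prod_measurable cdY.
have cslice (f : R * R -> R) (a b : R -> R) : continuous f -> continuous a ->
    continuous b -> continuous (fun y => f (a y, b y)).
  move=> cf ca cb y; apply: (@continuous_comp _ _ _ (fun y => (a y, b y)) f).
    exact: (cvg_pair (ca y) (cb y)).
  exact: cf.
have ccst (r : R) : continuous (fun _ : R => r) by move=> y; exact: cvg_cst.
have cid : continuous (fun y : R => y) by move=> y; exact: cvg_id.
have cN : continuous (fun y : R => - y) by move=> y; exact: continuousN.
have mb : measurable_fun (setT : set (measurableTypeR R)) (fun x => phi (x, 0)).
  by apply: continuous_measurable_fun; exact: cslice.
have mD : measurable_fun (setT : set (measurableTypeR R * measurableTypeR R))
    (fun z => ((phi z - phi (z.1, 0) * expR (- `|z.2|)) ^+ 2)%:E).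
  apply/measurable_EFinP/measurable_funX/measurable_funB => //.
  exact: measurable_snd_expRNnorm mb.
have mP : measurable_fun (setT : set (measurableTypeR R * measurableTypeR R))
    (fun z => (2 * (dY phi z ^+ 2 + phi z ^+ 2))%:E).
  apply/measurable_EFinP/measurable_funM => //.
  by apply: measurable_funD; exact: measurable_funX.
have P0 z : (0 <= (2 * (dY phi z ^+ 2 + phi z ^+ 2))%:E)%E.
  by rewrite lee_fin mulr_ge0// addr_ge0// sqr_ge0.
have D0 z : (0 <= ((phi z - phi (z.1, 0) * expR (- `|z.2|)) ^+ 2)%:E)%E.
  by rewrite lee_fin sqr_ge0.
have -> : (2%:E * (\int[leb2]_z (dY phi z ^+ 2)%:E + \int[leb2]_z (phi z ^+ 2)%:E) =
    \int[leb2]_z (2 * (dY phi z ^+ 2 + phi z ^+ 2))%:E)%E.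
  rewrite -ge0_integralD//; last 4 first.
  - by move=> z _; rewrite lee_fin sqr_ge0.
  - by apply/measurable_EFinP; exact: measurable_funX.
  - by move=> z _; rewrite lee_fin sqr_ge0.
  - by apply/measurable_EFinP; exact: measurable_funX.
  rewrite -ge0_integralZl_EFin//.
  - by move=> z _; rewrite -EFinD lee_fin addr_ge0// sqr_ge0.
  - by apply: emeasurable_funD; apply/measurable_EFinP; exact: measurable_funX.
have csum : continuous (fun s : R => phi (s, s) ^+ 2 + phi (s, - s) ^+ 2).
  have csqr (f : R -> R) : continuous f -> continuous (fun y => f y ^+ 2).
    move=> cf y; apply: (@continuous_comp _ _ _ f (fun z : R => z ^+ 2)).
      exact: cf.
    exact: exprn_continuous.
  have c1 := csqr _ (cslice _ _ _ cphi cid cid).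
  have c2 := csqr _ (cslice _ _ _ cphi cid cN).
  by move=> y; apply: cvgD; [exact: c1|exact: c2].
(* The broken line meets the slice at abscissa [s >= 0] in the points [(s, s)] and [(s, - s)], and
   misses the slices with [s < 0]. Extending by 0 turns the trace integral into one over all
   slices. *)
pose tr := (fun s : R => (2 * (phi (s, s) ^+ 2 + phi (s, - s) ^+ 2))%:E) \_ `[0, +oo[.
have mtr : measurable_fun (setT : set (measurableTypeR R)) tr.
  apply/(measurable_restrictT _ _).1; first exact: measurable_itv.
  apply/measurable_EFinP/measurable_funTS/measurable_funM => //.
  exact: continuous_measurable_fun.
have tr0 s : (0 <= tr s)%E.
  by rewrite /tr patchE; case: ifPn => // _; rewrite lee_fin mulr_ge0// addr_ge0// sqr_ge0.
have -> : (2%:E * \int[@lebesgue_measure R]_s (phi (`|s|, s) ^+ 2)%:E =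
    \int[@lebesgue_measure R]_s tr s)%E.
  have cabs : continuous (fun s : R => `|s|) by move=> s; exact: norm_continuous.
  have mabs : measurable_fun (setT : set (measurableTypeR R)) (fun s => phi (`|s|, s)).
    by apply: continuous_measurable_fun; exact: cslice.
  rewrite integral_fold; last 2 first.
  - by apply/measurable_EFinP; exact: measurable_funX.
  - by move=> s; rewrite lee_fin sqr_ge0.
  rewrite -ge0_integralD//=; last 4 first.
  - by move=> s _; rewrite lee_fin sqr_ge0.
  - by apply/measurable_EFinP/measurable_funTS; exact: measurable_funX.
  - by move=> s _; rewrite lee_fin sqr_ge0.
  - apply/measurable_EFinP/measurable_funTS/measurable_funX.
    by apply: (measurableT_comp mabs); exact: oppr_measurable.
  rewrite -ge0_integralZl_EFin//=; last 2 first.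
  - by move=> s _; rewrite -EFinD lee_fin addr_ge0// sqr_ge0.
  - apply: emeasurable_funD; apply/measurable_EFinP/measurable_funTS/measurable_funX => //.
    by apply: (measurableT_comp mabs); exact: oppr_measurable.
  rewrite /tr -integral_mkcond; apply: eq_integral => s.
  by rewrite inE/= in_itv/= andbT => s0; rewrite normrN ger0_norm// -EFinD -EFinM.
rewrite [X in (X + _ <= _)%E](fubini_tonelli1 _ mD D0).
rewrite [X in (_ <= X)%E](fubini_tonelli1 _ mP P0).
rewrite -ge0_integralD//; last 2 first.
- by move=> x _; apply: integral_ge0 => y _; exact: D0.
- exact: (measurable_fun_fubini_tonelli_F _ mD D0).
apply: ge0_le_integral => //.
- by move=> x _; apply: adde_ge0; [apply: integral_ge0 => y _; exact: D0|].
- by apply: emeasurable_funD => //; exact: (measurable_fun_fubini_tonelli_F _ mD D0).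
- exact: (measurable_fun_fubini_tonelli_F _ mP P0).
move=> x _; rewrite /fubini_F/=.
have lt (s : R) : 0 <= s -> _ := fun s0 => @line_trace R (fun y => phi (x, y)) s M s0
  (fun y => (dphi (x, y)).2) (cslice _ _ _ cdY (ccst x) cid)
  (fun y My => phiM (x, y) (or_intror My)).
rewrite /tr patchE; case: ifPn => [|_].
  by rewrite inE/= in_itv/= andbT => /lt; apply: le_trans.
(* A slice with [x < 0] carries no trace: the one-dimensional bound is used at the point 0 and its
   nonnegative trace term is discarded. *)
apply: le_trans (lt 0 (lexx _)); rewrite leeD2l// lee_fin.
by rewrite mulr_ge0// addr_ge0// sqr_ge0.
Qed.

(** * The slicewise projection [Pi0] *)

(** Tonelli yields measurable partial integrals for nonnegative functions, so positive and negative
    parts are treated separately. On slices with an infinite partial integral, [Rintegral] takes the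
    default value 0 through the measurable map [fine]. *)
Lemma measurable_Pi0 (R : realType) (psi : R * R -> R) :
  measurable_fun (setT : set (measurableTypeR R * measurableTypeR R)) psi ->
  measurable_fun (setT : set (measurableTypeR R * measurableTypeR R)) (Pi0 psi).
Proof.
move=> mpsi.
pose F (z : R * R) : \bar R := (psi z * expR (- `|z.2|))%:E.
have mF : measurable_fun (setT : set (measurableTypeR R * measurableTypeR R)) F.
  apply/measurable_EFinP/measurable_funM => //.
  by apply: (measurableT_comp (@measurable_expRNnorm R)); exact: measurable_snd.
have mI : measurable_fun (setT : set (measurableTypeR R))
    (fun x => \int[@lebesgue_measure R]_y F (x, y))%E.
  rewrite (_ : (fun _ => _) = (fun x => \int[@lebesgue_measure R]_y (F^\+ (x, y)) -
      \int[@lebesgue_measure R]_y (F^\- (x, y)))%E); last first.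
    apply/funext => x; rewrite [LHS]integralE.
    by congr (_ - _)%E; apply: eq_integral => y _; rewrite ?funeposE ?funenegE.
  apply: emeasurable_funB.
  - apply: (measurable_fun_fubini_tonelli_F (m2 := lebesgue_measure) _
      (measurable_funepos mF)) => z; exact: funepos_ge0.
  - apply: (measurable_fun_fubini_tonelli_F (m2 := lebesgue_measure) _
      (measurable_funeneg mF)) => z; exact: funeneg_ge0.
apply: (@measurable_snd_expRNnorm R
  (fun x => Rintegral lebesgue_measure setT (fun y => psi (x, y) * expR (- `|y|)))).
exact: (measurableT_comp (fine_measurable measurableT) mI).
Qed.

(** The coefficient [b] is left free so that it can later be [phi (., 0)] for an approximant [phi]
    of [psi]. *)
Lemma Pi0_best_approximation (R : realType) (psi : R * R -> R) (b : R -> R) :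
  measurable_fun (setT : set (measurableTypeR R * measurableTypeR R)) psi ->
  measurable_fun (setT : set (measurableTypeR R)) b ->
  (\int[leb2]_z ((psi z - Pi0 psi z) ^+ 2)%:E <=
   \int[leb2]_z ((psi z - b z.1 * expR (- `|z.2|)) ^+ 2)%:E)%E.
Proof.
move=> mpsi mb.
have mP : measurable_fun (setT : set (measurableTypeR R * measurableTypeR R))
    (fun z => ((psi z - Pi0 psi z) ^+ 2)%:E).
  by apply/measurable_EFinP/measurable_funX/measurable_funB => //; exact: measurable_Pi0.
have mB : measurable_fun (setT : set (measurableTypeR R * measurableTypeR R))
    (fun z => ((psi z - b z.1 * expR (- `|z.2|)) ^+ 2)%:E).
  by apply/measurable_EFinP/measurable_funX/measurable_funB => //; exact: measurable_snd_expRNnorm.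
have P0 z : (0 <= ((psi z - Pi0 psi z) ^+ 2)%:E)%E by rewrite lee_fin sqr_ge0.
have B0 z : (0 <= ((psi z - b z.1 * expR (- `|z.2|)) ^+ 2)%:E)%E.
  by rewrite lee_fin sqr_ge0.
rewrite [X in (X <= _)%E](fubini_tonelli1 _ mP P0).
rewrite [X in (_ <= X)%E](fubini_tonelli1 _ mB B0).
apply: ge0_le_integral => //.
- by move=> x _; apply: integral_ge0 => y _; exact: P0.
- exact: (measurable_fun_fubini_tonelli_F _ mP P0).
- exact: (measurable_fun_fubini_tonelli_F _ mB B0).
move=> x _; rewrite /fubini_F/Pi0/=.
apply: best_approximation.
- exact: measurable_expRNnorm.
- exact: integral_expRNnorm_sqr.
- exact: measurable_slice.
Qed.

(** * Passage from smooth approximants to [H^1] *)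

(** Young's parameter is matched to the distance [e]: the error is
    [(1 + e^{-1}) e^2 = e^2 + e <= 2 e]. *)
Lemma sqr_integral_close d (T : measurableType d) (R : realType)
    (mu : {measure set T -> \bar R}) (f g : T -> R) (e : R) : 0 < e < 1 ->
  measurable_fun setT f -> measurable_fun setT g ->
  (\int[mu]_t ((f t - g t) ^+ 2)%:E <= (e ^+ 2)%:E)%E ->
  (\int[mu]_t (f t ^+ 2)%:E <=
   (1 + e)%:E * \int[mu]_t (g t ^+ 2)%:E + (2 * e)%:E)%E.
Proof.
move=> /andP[e0 e1] mf mg fg.
apply: le_trans (sqr_integral_young mu e0 mf mg) _; rewrite leeD2l//.
apply: le_trans (lee_wpmul2l _ fg) _.
  by rewrite lee_fin addr_ge0// invr_ge0 ltW.
rewrite -EFinM lee_fin mulrDl mul1r expr2 mulKf ?gt_eqF//; nra.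
Qed.

Lemma ge0_le_EFin (R : realType) (X : \bar R) (r : R) :
  (0 <= X)%E -> (X <= r%:E)%E -> exists2 x, X = x%:E & 0 <= x.
Proof. by case: X => // x; rewrite lee_fin => x0 _; exists x. Qed.

(** Real arithmetic of the limit: [a], [b], [t], [s] belong to the [H^1] function, [A], [B], [T],
    [D] to its approximant. Doubling the bound on [D + 2 T] matches the [2 D] that bounds [s], which
    is how the constants 2 become 4. The error constants arise from [(1 + e)^2 <= 1 + 3 e] and
    [18 + 18 + 8 = 44]. *)
Lemma young_chain (R : realType) (e a b t s A B D T : R) : 0 < e < 1 ->
  0 <= a -> 0 <= b -> 0 <= s ->
  A <= (1 + e) * a + 2 * e -> B <= (1 + e) * b + 2 * e ->
  t <= (1 + e) * T + 2 * e -> D + 2 * T <= 2 * (A + B) ->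
  s <= 2 * D + 2 * e ^+ 2 ->
  s + 4 * t <= 4 * (a + b) + e * (12 * (a + b) + 44).
Proof.
move=> /andP[e0 e1] a0 b0 s0 leA leB let_ leD les.
have e2 : e ^+ 2 <= e by rewrite expr2 ler_piMr; lra.
have le1 : s + 4 * T <= 4 * ((1 + e) * (a + b)) + 18 * e by lra.
have se : 0 <= e * s by rewrite mulr_ge0// ltW.
have le2 : s + 4 * t <= (1 + e) * (s + 4 * T) + 8 * e by lra.
have le3 : (1 + e) * (s + 4 * T) <= (1 + e) * (4 * ((1 + e) * (a + b)) + 18 * e).
  by rewrite ler_pM2l//; lra.
have le5 : e ^+ 2 * (a + b) <= e * (a + b) by rewrite ler_wpM2r// addr_ge0.
lra.
Qed.

(** [tau] is tied to [psi] only through the approximating sequence, so the smooth inequality is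
    carried over along that very sequence, with an error linear in [e]. *)
Lemma trace_spectral_gap (R : realType) (psi gx gy : R * R -> R) (tau : R -> R) :
  H1tr psi gx gy tau ->
  (\int[leb2]_z ((psi z - Pi0 psi z) ^+ 2)%:E +
     4%:E * \int[@lebesgue_measure R]_s (tau s ^+ 2)%:E <=
   4%:E * (\int[leb2]_z (gy z ^+ 2)%:E + \int[leb2]_z (psi z ^+ 2)%:E))%E.
Proof.
move=> [[[mpsi psioo] [_ [[mgy gyoo] _]]] [[mtau tauoo] [phi [C1phi [cvg1 cvg2]]]]].
have ge0_int d (T : measurableType d) (mu : {measure set T -> \bar R}) (f : T -> R) :
    (0 <= \int[mu]_t (f t ^+ 2)%:E)%E.
  by apply: integral_ge0 => t _; rewrite lee_fin sqr_ge0.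
have fin d (T : measurableType d) (mu : {measure set T -> \bar R}) (f : T -> R) :
    (\int[mu]_t (f t ^+ 2)%:E < +oo)%E ->
    exists2 x, (\int[mu]_t (f t ^+ 2)%:E = x%:E)%E & 0 <= x.
  by have := ge0_int d T mu f; case: (integral _ _ _) => // x; rewrite lee_fin; exists x.
have [a aE a0] := fin _ _ _ _ gyoo; have [b bE b0] := fin _ _ _ _ psioo.
have [t tE t0] := fin _ _ _ _ tauoo.
rewrite aE bE tE.
set S := (\int[leb2]_z _)%E.
have key e : 0 < e < 1 -> exists2 s, S = s%:E &
    s + 4 * t <= 4 * (a + b) + e * (12 * (a + b) + 44).
  move=> e01; have /andP[e0 e1] := e01.
  have e20 : (0 < (e ^+ 2)%:E)%E by rewrite lte_fin exprn_gt0.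
  have near_lt (v : nat -> \bar R) : v n @[n --> \oo] --> 0%E ->
      \forall n \near \oo, (v n < (e ^+ 2)%:E)%E.
    by move=> cv; exact: cv _ (open_ereal_lt' e20).
  (* One index serves both convergences: the approximant is close to [psi] in [H^1] and its trace is
     close to [tau]. *)
  have [n [/= lt1 lt2]] : exists n,
      (\int[leb2]_z ((phi n z - psi z) ^+ 2)%:E
       + \int[leb2]_z ((dX (phi n) z - gx z) ^+ 2)%:E
       + \int[leb2]_z ((dY (phi n) z - gy z) ^+ 2)%:E < (e ^+ 2)%:E)%E /\
      (\int[@lebesgue_measure R]_s ((phi n (`|s|, s) - tau s) ^+ 2)%:E < (e ^+ 2)%:E)%E.
    exact: (filter_ex (filterI (near_lt _ cvg1) (near_lt _ cvg2))).
  have psi_close : (\int[leb2]_z ((phi n z - psi z) ^+ 2)%:E <= (e ^+ 2)%:E)%E.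
    by apply: le_trans (ltW lt1); rewrite -addeA leeDl// adde_ge0// ge0_int.
  have gy_close : (\int[leb2]_z ((dY (phi n) z - gy z) ^+ 2)%:E <= (e ^+ 2)%:E)%E.
    by apply: le_trans (ltW lt1); rewrite leeDr// adde_ge0// ge0_int.
  have [_ [_ [cphi [_ cdY]]]] := C1phi n.
  have mphi := continuous_prod_measurable cphi.
  have mdY := continuous_prod_measurable cdY.
  have mtr : measurable_fun (setT : set (measurableTypeR R)) (fun s => phi n (`|s|, s)).
    by apply: (measurableT_comp mphi); apply: measurable_fun_pair.
  have mb : measurable_fun (setT : set (measurableTypeR R)) (fun x => phi n (x, 0)).
    by apply: (measurableT_comp mphi); apply: measurable_fun_pair.
  have mbE := measurable_snd_expRNnorm mb.
  have tau_close : (\int[@lebesgue_measure R]_s ((tau s - phi n (`|s|, s)) ^+ 2)%:E <=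
      (e ^+ 2)%:E)%E.
    apply: le_trans (ltW lt2); rewrite le_eqVlt; apply/orP; left; apply/eqP.
    by apply: eq_integral => s _; congr EFin; ring.
  have := sqr_integral_close e01 mphi mpsi psi_close; rewrite bE.
  have := sqr_integral_close e01 mdY mgy gy_close; rewrite aE.
  have := sqr_integral_close e01 mtau mtr tau_close; rewrite tE.
  have := C1c_trace_ineq (C1phi n).
  have : (S <= 2%:E * \int[leb2]_z ((phi n z - phi n (z.1, 0) * expR (- `|z.2|)) ^+ 2)%:E +
      (2 * e ^+ 2)%:E)%E.
    (* [Pi0 psi] is replaced by the profile of the approximant; Young's inequality with parameter 1
       then exchanges [psi] for [phi n], at the price of a factor 2. *)
    apply: le_trans (Pi0_best_approximation mpsi mb) _.
    have := sqr_integral_young leb2 ltr01 (measurable_funB mpsi mbE) (measurable_funB mphi mbE).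
    move=> /le_trans; apply; rewrite invr1 (_ : 1 + 1 = 2)//.
    rewrite leeD2l// EFinM lee_wpmul2l//.
    apply: le_trans psi_close; rewrite le_eqVlt; apply/orP; left; apply/eqP.
    by apply: eq_integral => z _; congr EFin => /=; ring.
  set D := (\int[leb2]_z _)%E; set T := (\int[_]_s _)%E.
  set A := (\int[leb2]_z (dY _ _ ^+ 2)%:E)%E; set B := (\int[leb2]_z _)%E.
  have D0 : (0 <= D)%E by exact: ge0_int.
  have T0 : (0 <= T)%E by exact: ge0_int.
  have A0 : (0 <= A)%E by exact: ge0_int.
  have B0 : (0 <= B)%E by exact: ge0_int.
  have S0 : (0 <= S)%E by exact: ge0_int.
  move=> SD + + leA leB.
  (* Finiteness propagates: [A] and [B] are bounded by real numbers, then [D] and [T] by [A] and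
     [B], and finally [S] by [D]. *)
  have [A' AE A'0] := ge0_le_EFin A0 leA; have [B' BE B'0] := ge0_le_EFin B0 leB.
  move: leA leB; rewrite AE BE -!EFinM -!EFinD !lee_fin => leA leB leDT leT.
  have DT0 : (0 <= 2%:E * T)%E by rewrite mule_ge0.
  have [D' DE D'0] := ge0_le_EFin D0 (le_trans (leeDl _ DT0) leDT).
  have [T' TE T'0] := ge0_le_EFin DT0 (le_trans (leeDr _ D0) leDT).
  have [T2 T2E _] : exists2 x, T = x%:E & 0 <= x.
    move: TE T0; case: (T) => [x _|/=|//]; first by rewrite lee_fin; exists x.
    by rewrite mulry gtr0_sg// mul1e.
  move: leDT leT SD; rewrite DE T2E -!EFinM -!EFinD !lee_fin => leDT leT SD.
  have [s sE s0] := ge0_le_EFin S0 SD; exists s => //.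
  move: SD; rewrite sE lee_fin => SD.
  exact: (young_chain (A := A') (B := B') (D := D') (T := T2)).
have half : 0 < 1 / 2 :> R by lra.
(* One admissible [e] suffices to know that [S] is real; afterwards [e] is free to tend to 0. *)
have [s SE _] := key (1 / 2) ltac:(lra).
rewrite SE -EFinM -!EFinD -EFinM lee_fin.
set K := 12 * (a + b) + 44.
have K0 : 0 < K by rewrite /K; lra.
apply/ler_addgt0Pr => eps eps0.
(* The error [e * K] is then at most [eps], and [e] stays below 1. *)
pose e := Num.min (1 / 2) (eps / K).
have e0 : 0 < e by rewrite /e lt_min half divr_gt0.
have e1 : e < 1 by rewrite /e gt_min; apply/orP; left; lra.
have [s'] := key e ltac:(by rewrite e0 e1); rewrite SE => -[<-] /le_trans; apply.
by rewrite lerD2l -ler_pdivlMr// /e ge_min lexx orbT.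
Qed.

(** * Low-energy eigenpairs *)

(** Dropping [h^2 ||ux||^2 >= 0] from the energy identity gives
    [||uy||^2 - ||tu||^2 <= lam ||u||^2], which is inserted into [trace_spectral_gap]. *)
Lemma low_energy_bound (R : realType) (h lam k : R) (u ux uy : R * R -> R)
    (tu : R -> R) : H1tr u ux uy tu ->
  Qform h ux uy ux uy tu tu = lam * ip2 u u -> lam <= -1 + k ->
  (\int[leb2]_z ((u z - Pi0 u z) ^+ 2)%:E <= (4 * k)%:E * \int[leb2]_z (u z ^+ 2)%:E)%E.
Proof.
move=> H1u; have := trace_spectral_gap H1u.
case: H1u => [[[mu uoo] [[mux uxoo] [[muy uyoo] _]]] [[mtu tuoo] _]].
have fin d (T : measurableType d) (mu0 : {measure set T -> \bar R}) (f : T -> R) :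
    (\int[mu0]_t (f t ^+ 2)%:E < +oo)%E ->
    (\int[mu0]_t (f t ^+ 2)%:E = (Rintegral mu0 setT (fun t => f t * f t))%:E)%E.
  move=> foo; rewrite /Rintegral fineK; first by apply: eq_integral.
  rewrite ge0_fin_numE//; apply: integral_ge0 => t _.
  by rewrite lee_fin -expr2 sqr_ge0.
rewrite (fin _ _ _ _ uoo) (fin _ _ _ _ uyoo) (fin _ _ _ _ tuoo) -/(ip2 u u) -/(ip2 uy uy).
have u0 : 0 <= ip2 u u by apply: Rintegral_ge0 => z _; rewrite -expr2 sqr_ge0.
have ux0 : 0 <= h ^+ 2 * ip2 ux ux.
  by rewrite mulr_ge0 ?sqr_ge0//; apply: Rintegral_ge0 => z _; rewrite -expr2 sqr_ge0.
rewrite /Qform; set T := Rintegral _ _ _ => gap Q lamk.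
have [S SE] : exists S, (\int[leb2]_z ((u z - Pi0 u z) ^+ 2)%:E = S%:E)%E.
  have S0 : (0 <= \int[leb2]_z ((u z - Pi0 u z) ^+ 2)%:E)%E.
    by apply: integral_ge0 => z _; rewrite lee_fin sqr_ge0.
  case: (integral _ _ _) S0 gap => [S _ _|_|//]; first by exists S.
  by rewrite -EFinD -!EFinM.
move: gap; rewrite SE -!EFinM -!EFinD !lee_fin => gap.
have : lam * ip2 u u <= (-1 + k) * ip2 u u by rewrite ler_wpM2r.
lra.
Qed.

Unset Implicit Arguments.

Theorem mainTheorem4 (R : realType) (C0 : R) : 0 < C0 ->
  exists h0 C : R, 0 < h0 /\ 0 < C /\
  forall (h lam : R) (u w : R * R -> R),
    0 < h -> h < h0 ->
    eigenpair h lam u w ->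
    lam <= -1 + C0 * powR h (2 / 3) ->
    (\int[leb2]_z ((u z - Pi0 u z) ^+ 2 + (w z - Pi0 w z) ^+ 2)%:E
     <= (C * powR h (2 / 3))%:E * \int[leb2]_z ((u z) ^+ 2 + (w z) ^+ 2)%:E)%E.
Proof.
move=> C00; exists 1, (4 * C0); split; [lra|split; [lra|]].
move=> h lam u w _ _ [ux [uy [wx [wy [tu [tw [Hu [Hw [_ eig]]]]]]]]] lamle.
(* The weak equation is tested with the real and the imaginary part themselves. [Pi0] acts on each
   part separately, so the two squared bounds add up. *)
have Su := low_energy_bound Hu (eig _ _ _ _ Hu).1 lamle.
have Sw := low_energy_bound Hw (eig _ _ _ _ Hw).2 lamle.
have mu : measurable_fun (setT : set (measurableTypeR R * measurableTypeR R)) u.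
  by case: Hu => [[[]]].
have mw : measurable_fun (setT : set (measurableTypeR R * measurableTypeR R)) w.
  by case: Hw => [[[]]].
have sumE (f g : R * R -> R) :
    measurable_fun (setT : set (measurableTypeR R * measurableTypeR R)) f ->
    measurable_fun (setT : set (measurableTypeR R * measurableTypeR R)) g ->
    (\int[leb2]_z (f z ^+ 2 + g z ^+ 2)%:E =
     \int[leb2]_z (f z ^+ 2)%:E + \int[leb2]_z (g z ^+ 2)%:E)%E.
  move=> mf mg; rewrite -ge0_integralD//.
  - by move=> z _; rewrite lee_fin sqr_ge0.
  - by apply/measurable_EFinP; exact: measurable_funX.
  - by move=> z _; rewrite lee_fin sqr_ge0.
  - by apply/measurable_EFinP; exact: measurable_funX.
rewrite (sumE (fun z => u z - Pi0 u z) (fun z => w z - Pi0 w z)); last 2 first.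
- by apply: measurable_funB => //; exact: measurable_Pi0.
- by apply: measurable_funB => //; exact: measurable_Pi0.
rewrite sumE// ge0_muleDr; last 2 first.
- by apply: integral_ge0 => z _; rewrite lee_fin sqr_ge0.
- by apply: integral_ge0 => z _; rewrite lee_fin sqr_ge0.
by rewrite -!mulrA; apply: leeD.
Qed.
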